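(* For all $\alpha,\beta\in\mathrm{ASP}$, the following three maxima in Bruhat order all exist, and all are equal to $\alpha\star\beta$: $$\alpha\star\beta=\max\{\alpha_1\beta_1:\ \alpha_1,\beta_1\in\mathrm{ASP},\ \alpha_1\le\alpha\text{ and }\beta_1\le\beta\}$$ $$=\max\{\alpha\beta_1:\ \beta_1\in\mathrm{ASP},\ \beta_1\le_\chi\beta\}$$ $$=\max\{\alpha_1\beta:\ \alpha_1\in\mathrm{ASP},\ \alpha_1\le_\chi\alpha\}.$$
   Context: A permutation means a bijection $\mathbb{Z}\to\mathbb{Z}$; products of permutations are compositions. $\mathrm{ASP}$ is the group of permutations $\alpha$ for which only finitely many $n\in\mathbb{Z}$ have exactly one of $n,\alpha(n)$ negative. For $\alpha\in\mathrm{ASP}$, $s_\alpha(a,b)=\#\{n\ge b:\ \alpha(n)<a\}$ for $a,b\in\mathbb{Z}$ (always finite; $s_\alpha$ determines $\alpha$). The shift of $\alpha$ is $\chi_\alpha=s_\alpha(0,0)-s_{\alpha^{-1}}(0,0)$. Bruhat order on $\mathrm{ASP}$: $\alpha\le\beta$ means $s_\alpha(a,b)\le s_\beta(a,b)$ for all $a,b\in\mathbb{Z}$. Write $\alpha\le_\chi\beta$ if $\alpha\le\beta$ and $\chi_\alpha=\chi_\beta$. The Demazure product $\alpha\star\beta$ is the unique element of $\mathrm{ASP}$ such that $s_{\alpha\star\beta}(a,b)=\min_{\ell\in\mathbb{Z}}[s_\alpha(a,\ell)+s_\beta(\ell,b)]$ for all $a,b\in\mathbb{Z}$ (such an element always exists).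 *)

(* Defs.v *)
From HB Require Import structures.
From mathcomp Require Import all_boot all_order all_algebra finmap.
From mathcomp Require Import mathcomp_extra boolp classical_sets functions cardinality.
From mathcomp Require Import zify.
Set Implicit Arguments.
Unset Strict Implicit.
Unset Printing Implicit Defensive.
Import Order.TTheory GRing.Theory Num.Theory.
Local Open Scope classical_set_scope.
Local Open Scope ring_scope.

(* The inverse is carried as data; it and the proof components are determined
   by the underlying function (see [asp_ext]). *)
Record ASP := MkASP {
  asp_fun :> int -> int;
  asp_inv : int -> int;
  asp_funK : cancel asp_fun asp_inv;
  asp_invK : cancel asp_inv asp_fun;
  asp_sign : finite_set [set n : int | (n < 0) != (asp_fun n < 0)] }.

HB.instance Definition _ := gen_eqMixin ASP.
HB.instance Definition _ := gen_choiceMixin ASP.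

Lemma asp_ext (alpha beta : ASP) : alpha =1 beta -> alpha = beta.
Proof.
case: alpha beta => [f f' fK f'K Sf] [g g' gK g'K Sg] /= /funext fg.
case: _ / fg in gK g'K Sg *.
have fg' : f' = g' by apply/funext => x; rewrite -[x in LHS]g'K fK.
case: _ / fg' in gK g'K *.
by congr MkASP; exact: Prop_irrelevance.
Qed.

Definition asp_one : ASP.
Proof.
apply: (@MkASP id id) => //.
by rewrite [X in finite_set X](_ : _ = set0) // -subset0 => n /=; rewrite eqxx.
Defined.

Definition asp_V (alpha : ASP) : ASP.
Proof.
apply: (@MkASP (asp_inv alpha) alpha (asp_invK alpha) (asp_funK alpha)).
apply: (sub_finite_set _ (finite_image alpha (asp_sign alpha))) => n /= nP.
by exists (asp_inv alpha n); rewrite asp_invK // eq_sym.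
Defined.

Definition asp_mul (alpha beta : ASP) : ASP.
Proof.
apply: (@MkASP (alpha \o beta) (asp_inv beta \o asp_inv alpha)).
- exact: (can_comp (asp_funK alpha) (asp_funK beta)).
- exact: (can_comp (asp_invK beta) (asp_invK alpha)).
have fin_aux := finite_image (asp_inv beta) (asp_sign alpha).
have : finite_set ([set n : int | (n < 0) != (beta n < 0)] `|`
    asp_inv beta @` [set n : int | (n < 0) != (alpha n < 0)]).
  by rewrite finite_setU; split => //; exact: asp_sign.
apply: sub_finite_set => n /= nP.
have [eq_b|] := eqVneq (n < 0) (beta n < 0); last by left.
by right; exists (beta n); rewrite ?asp_funK // -eq_b.
Defined.

Fact asp_mulA : associative asp_mul. Proof. by move=> *; apply: asp_ext. Qed.
Fact asp_mul1 : left_id asp_one asp_mul. Proof. by move=> *; apply: asp_ext. Qed.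
Fact asp_mulr1 : right_id asp_one asp_mul. Proof. by move=> *; apply: asp_ext. Qed.
Fact asp_mulV : left_inverse asp_one asp_V asp_mul.
Proof. by move=> alpha; apply: asp_ext => n /=; rewrite asp_funK. Qed.
Fact asp_mulrV : right_inverse asp_one asp_V asp_mul.
Proof. by move=> alpha; apply: asp_ext => n /=; rewrite asp_invK. Qed.

HB.instance Definition _ :=
  isGroup.Build ASP asp_mulA asp_mul1 asp_mulr1 asp_mulV asp_mulrV.

Lemma asp_mulE (alpha beta : ASP) n : (alpha * beta)%g n = alpha (beta n).
Proof. by []. Qed.

Lemma asp_invE (alpha : ASP) : (alpha^-1)%g =1 asp_inv alpha.
Proof. by []. Qed.

(* [fset_set] is empty on infinite sets; see [finite_asp_s]. *)
Definition asp_s (alpha : ASP) (a b : int) : nat :=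
  #|` fset_set [set n : int | b <= n /\ alpha n < a]|.

Lemma finite_int_itv (l u : int) : finite_set [set n : int | l <= n < u].
Proof.
apply: (sub_finite_set _
  (finite_image (fun k : nat => l + k%:Z) (finite_II `|u - l|%N))) => n /= lnu.
by exists `|n - l|%N => /=; lia.
Qed.

Lemma finite_asp_s (alpha : ASP) (a b : int) :
  finite_set [set n : int | b <= n /\ alpha n < a].
Proof.
have : finite_set ([set n : int | (n < 0) != (alpha n < 0)] `|`
   ([set n : int | b <= n < 0] `|` asp_inv alpha @` [set n : int | 0 <= n < a])).
  rewrite !finite_setU; split; first exact: asp_sign.
  by split; [exact: finite_int_itv | apply: finite_image; exact: finite_int_itv].
apply: sub_finite_set => n /= [bn na].
have [n0|n0] := ltP n 0; first by right; left; rewrite bn.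
have [an0|an0] := ltP (alpha n) 0; first by left.
by right; right; exists (alpha n); rewrite ?asp_funK // an0.
Qed.

Lemma asp_s_rec (alpha : ASP) (a b : int) :
  asp_s alpha a b = ((alpha b < a)%R + asp_s alpha a (b + 1))%N.
Proof.
have fin := finite_asp_s alpha a.
have [ab|ab] := boolP (alpha b < a); last first.
  congr (#|` fset_set _|); apply/seteqP; split => n /= [bn na]; split => //; last by lia.
  have : b != n by apply: contraNneq ab => ->.
  lia.
rewrite /asp_s -[RHS]/(1 + _)%N.
have -> : [set n : int | b <= n /\ alpha n < a] =
    b |` [set n : int | b + 1 <= n /\ alpha n < a].
  apply/seteqP; split => n /=.
    move=> [bn na]; have [->|nb] := eqVneq n b; first by left.
    by right; split => //; lia.
  by move=> [->|[bn na]]; split => //; lia.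
rewrite fset_setU1 //  cardfsU1 in_fset_set //.
by rewrite (_ : (b \in _) = false) //; apply/negbTE/negP; rewrite inE /=; lia.
Qed.

Lemma asp_s_inj (alpha beta : ASP) : asp_s alpha =2 asp_s beta -> alpha = beta.
Proof.
move=> eq_s; apply: asp_ext => b.
have lt_iff a : (alpha b < a) = (beta b < a).
  have := eq_s a b; rewrite !(asp_s_rec _ _ b) eq_s => /eqP; rewrite eqn_add2r.
  by case: (alpha b < a); case: (beta b < a).
have := lt_iff (alpha b + 1); have := lt_iff (beta b + 1); lia.
Qed.

Definition asp_chi (alpha : ASP) : int :=
  (asp_s alpha 0 0)%:Z - (asp_s (alpha^-1)%g 0 0)%:Z.

Definition bruhat_le (alpha beta : ASP) : bool :=
  `[< forall a b : int, (asp_s alpha a b <= asp_s beta a b)%N >].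

Fact bruhat_le_refl : reflexive bruhat_le.
Proof. by move=> alpha; apply/asboolP. Qed.
Fact bruhat_le_anti : antisymmetric bruhat_le.
Proof.
move=> alpha beta /andP[/asboolP ab /asboolP ba]; apply: asp_s_inj => a b.
by apply/eqP; rewrite eqn_leq ab ba.
Qed.
Fact bruhat_le_trans : transitive bruhat_le.
Proof.
move=> beta alpha gamma /asboolP ab /asboolP bc; apply/asboolP => a b.
exact: leq_trans (ab a b) (bc a b).
Qed.

Fact bruhat_display : Order.disp_t. Proof. by split; exact: tt. Qed.

HB.instance Definition _ := Order.Le_isPOrder.Build bruhat_display ASP
  bruhat_le_refl bruhat_le_anti bruhat_le_trans.

Lemma bruhat_leP (alpha beta : ASP) :
  reflect (forall a b, (asp_s alpha a b <= asp_s beta a b)%N) (alpha <= beta)%O.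
Proof. exact: asboolP. Qed.

Definition bruhat_chi_le (alpha beta : ASP) : Prop :=
  (alpha <= beta)%O /\ asp_chi alpha = asp_chi beta.

Definition is_max {d} {T : porderType d} (A : set T) (m : T) : Prop :=
  A m /\ ubound A m.

Definition is_min {d} {T : porderType d} (A : set T) (m : T) : Prop :=
  A m /\ lbound A m.

Definition is_demazure (alpha beta gamma : ASP) : Prop :=
  forall a b : int,
    is_min [set (asp_s alpha a l + asp_s beta l b)%N | l in [set: int]]
           (asp_s gamma a b).

Lemma is_demazure_unique (alpha beta : ASP) : is_subset1 (is_demazure alpha beta).
Proof.
move=> g1 g2 D1 D2; apply: asp_s_inj => a b.
have [[A1 L1] [A2 L2]] := (D1 a b, D2 a b).
by apply/le_anti; rewrite L1 // L2.
Qed.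


Lemma asp_s_recl (alpha : ASP) (a b : int) :
  asp_s alpha (a + 1) b = ((b <= asp_inv alpha a)%R + asp_s alpha a b)%N.
Proof.
have fin := finite_asp_s alpha ^~ b.
have [ba|ba] := boolP (b <= asp_inv alpha a); last first.
  congr (#|` fset_set _|); apply/seteqP; split => n /= [bn na]; split => //; last by lia.
  have : alpha n != a by apply: contraNneq ba => <-; rewrite asp_funK.
  lia.
rewrite /asp_s -[RHS]/(1 + _)%N.
have -> : [set n : int | b <= n /\ alpha n < a + 1] =
    asp_inv alpha a |` [set n : int | b <= n /\ alpha n < a].
  apply/seteqP; split => n /=.
    move=> [bn na]; have [<-|nb] := eqVneq (alpha n) a; first by left; rewrite asp_funK.
    by right; split => //; lia.
  by move=> [->|[bn na]]; [rewrite asp_invK | ]; split => //; lia.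
rewrite fset_setU1 // cardfsU1 in_fset_set //.
rewrite (_ : (_ \in _) = false) //; apply/negbTE/negP.
by rewrite inE /= asp_invK; lia.
Qed.

Lemma int_iff_ind (P : int -> Prop) (m : int) : P m ->
  (forall n, P n <-> P (n + 1)) -> forall n, P n.
Proof.
move=> Pm PS n; have up k l : P l -> P (l + k%:Z).
  elim: k => [|k IH] Pl; first by rewrite addr0.
  by rewrite -addn1 PoszD addrA -PS; apply: IH.
have dn k l : P (l + k%:Z) -> P l.
  elim: k => [|k IH]; first by rewrite addr0.
  by rewrite -addn1 PoszD addrA -PS.
have [mn|nm] := leP m n.
  by have := up `|n - m|%N m Pm; rewrite (_ : m + _ = n) //; lia.
by apply: (dn `|m - n|%N); rewrite (_ : n + _ = m) //; lia.
Qed.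

Lemma asp_s_dual (alpha : ASP) (a b : int) :
  (asp_s alpha a b)%:Z = (asp_s (alpha^-1)%g b a)%:Z + (a - b) + asp_chi alpha.
Proof.
pose Q a b := (asp_s alpha a b)%:Z =
  (asp_s (alpha^-1)%g b a)%:Z + (a - b) + asp_chi alpha.
rewrite -/(Q a b); move: a b.
apply: (@int_iff_ind (fun a => forall b, Q a b) 0) => [|a].
  apply: (@int_iff_ind (Q 0) 0) => [|b]; rewrite /Q; first by rewrite /asp_chi; lia.
  by rewrite asp_s_rec asp_s_recl; have -> : asp_inv (alpha^-1)%g = alpha by []; lia.
have step b : (asp_s alpha (a + 1) b)%:Z - (asp_s (alpha^-1)%g b (a + 1))%:Z =
    (asp_s alpha a b)%:Z - (asp_s (alpha^-1)%g b a)%:Z + 1.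
  by rewrite asp_s_recl (asp_s_rec _ b a) asp_invE; lia.
by rewrite /Q; split => H b; move: (step b) (H b); lia.
Qed.

Lemma asp_s_nincr (alpha : ASP) (a b b' : int) : b <= b' ->
  (asp_s alpha a b' <= asp_s alpha a b)%N.
Proof.
move=> bb'; apply: fsubset_leq_card.
by rewrite -fset_set_sub; [move=> n /=; lia | exact: finite_asp_s..].
Qed.

Lemma asp_s_ndecr (alpha : ASP) (a a' b : int) : a <= a' ->
  (asp_s alpha a b <= asp_s alpha a' b)%N.
Proof.
move=> aa'; apply: fsubset_leq_card.
by rewrite -fset_set_sub; [move=> n /=; lia | exact: finite_asp_s..].
Qed.

Lemma asp_s_eq0 (alpha : ASP) (a b : int) :
  (forall n, b <= n -> a <= alpha n) -> asp_s alpha a b = 0%N.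
Proof.
move=> H; rewrite /asp_s (_ : [set _ | _] = set0) ?fset_set0 ?cardfs0 //.
by rewrite -subset0 => n /= [/H]; lia.
Qed.

Lemma finite_int_bound (A : set int) : finite_set A ->
  exists B : int, forall n, A n -> n < B.
Proof.
move=> finA; exists (\sum_(n <- fset_set A) `|n| + 1) => n An.
have nA : n \in fset_set A by rewrite in_fset_set // inE.
rewrite (big_fsetD1 n) //=.
by rewrite ltzD1 (le_trans (ler_norm n)) // lerDl sumr_ge0.
Qed.

Lemma asp_s_eq0r (alpha : ASP) (a : int) : exists b, asp_s alpha a b = 0%N.
Proof.
have [B BP] := finite_int_bound (finite_asp_s alpha a 0).
exists (Num.max B 0); apply: asp_s_eq0 => n Bn.
by rewrite leNgt; apply/negP => na; have /= := BP n; lia.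
Qed.

Lemma asp_s_eq0l (alpha : ASP) (b : int) : exists a, asp_s alpha a b = 0%N.
Proof.
have [B BP] := finite_int_bound (finite_image (fun n => - alpha n) (finite_asp_s alpha 0 b)).
exists (- Num.max B 0); apply: asp_s_eq0 => n bn.
rewrite leNgt; apply/negP => na; have : - alpha n < B; last by lia.
by apply: BP; exists n => //=; lia.
Qed.

Lemma int_crossing (P : pred int) (u v : int) :
  (forall n, P n -> P (n + 1)) -> ~~ P u -> P v ->
  exists m, forall n, P n = (m < n).
Proof.
move=> PS Pu Pv.
have up l n : P l -> l <= n -> P n.
  move=> Pl ln; have -> : n = l + `|n - l|%N%:Z by lia.
  by elim: `|_|%N => [|k IH]; rewrite ?addr0 // -addn1 PoszD addrA; apply: PS.
have uv : u < v by rewrite ltNge; apply: contra Pu; exact: up.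
have exP : exists k : nat, P (u + k%:Z).
  by exists `|v - u|%N; rewrite (_ : _ + _ = v) //; lia.
case: (ex_minnP exP) => -[|k] Pk kmin; first by rewrite addr0 (negPf Pu) in Pk.
exists (u + k%:Z) => n; have [kn|nk] := ltP (u + k%:Z) n.
  by apply: up Pk _; lia.
apply/negbTE/negP => Pn.
have /kmin : P (u + k%:Z) by exact: up nk.
by rewrite ltnn.
Qed.

Section Existence.
Variables alpha beta : ASP.

Let ex_t (a b : int) :
  exists n : nat, `[< exists l, (asp_s alpha a l + asp_s beta l b)%N = n >].
Proof. by exists (asp_s alpha a 0 + asp_s beta 0 b)%N; apply/asboolP; exists 0. Qed.

Let t (a b : int) : nat := ex_minn (ex_t a b).

Let t_le (a b l : int) : (t a b <= asp_s alpha a l + asp_s beta l b)%N.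
Proof. by rewrite /t; case: ex_minnP => n _; apply; apply/asboolP; exists l. Qed.

Let t_att (a b : int) : exists l, t a b = (asp_s alpha a l + asp_s beta l b)%N.
Proof. by rewrite /t; case: ex_minnP => n /asboolP[l <-] _; exists l. Qed.

Let t_stepr (a b : int) : (t a (b + 1) <= t a b <= (t a (b + 1)).+1)%N.
Proof.
have [l lE] := t_att a b; have [l' lE'] := t_att a (b + 1).
move: (t_le a (b + 1) l) (t_le a b l') lE lE'.
by rewrite (asp_s_rec beta l b) (asp_s_rec beta l' b); lia.
Qed.

Let t_stepl (a b : int) : (t a b <= t (a + 1) b <= (t a b).+1)%N.
Proof.
have [l lE] := t_att a b; have [l' lE'] := t_att (a + 1) b.
move: (t_le (a + 1) b l) (t_le a b l') lE lE'.
by rewrite !asp_s_recl; lia.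
Qed.

Let t_monge (a b : int) : (t a b + t (a + 1) (b + 1) <= t (a + 1) b + t a (b + 1))%N.
Proof.
have [l lE] := t_att (a + 1) b; have [l' lE'] := t_att a (b + 1).
have [ll'|l'l] := ltP l l'.
  move: (t_le a b l) (t_le (a + 1) (b + 1) l') lE lE'.
  by rewrite !asp_s_recl; lia.
move: (t_le a b l') (t_le (a + 1) (b + 1) l) lE lE'.
by rewrite (asp_s_rec beta l b) (asp_s_rec beta l' b); lia.
Qed.

Let c := asp_chi alpha + asp_chi beta.

Let t_ge (a b : int) : a - b + c <= (t a b)%:Z.
Proof.
have [l ->] := t_att a b; rewrite PoszD.
by rewrite (asp_s_dual alpha) (asp_s_dual beta) /c; lia.
Qed.

Let t0r (a : int) : exists b : int, forall b' : int, b <= b' -> t a b' = 0%N.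
Proof.
have [l lE] := asp_s_eq0r alpha a; have [b bE] := asp_s_eq0r beta l.
exists b => b' bb'; have := t_le a b' l; have := asp_s_nincr beta l bb'; lia.
Qed.

Let t0l (b : int) : exists a : int, forall a' : int, a' <= a -> t a' b = 0%N.
Proof.
have [l lE] := asp_s_eq0l beta b; have [a aE] := asp_s_eq0l alpha l.
exists a => a' aa'; have := t_le a' b l; have := asp_s_ndecr alpha l aa'; lia.
Qed.

Let t1r (a : int) : exists b : int, forall b' : int, b' <= b -> (t a b')%:Z = a - b' + c.
Proof.
have [l lE] := asp_s_eq0l (alpha^-1)%g a; have [b bE] := asp_s_eq0l (beta^-1)%g l.
exists b => b' bb'; have := asp_s_ndecr (beta^-1)%g l bb'.
move: (t_le a b' l) (t_ge a b') (asp_s_dual alpha a l) (asp_s_dual beta l b').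
by rewrite /c; lia.
Qed.

Let t1l (b : int) : exists a : int, forall a' : int, a <= a' -> (t a' b)%:Z = a' - b + c.
Proof.
have [l lE] := asp_s_eq0r (beta^-1)%g b; have [a aE] := asp_s_eq0r (alpha^-1)%g l.
exists a => a' aa'; have := asp_s_nincr (alpha^-1)%g l aa'.
move: (t_le a' b l) (t_ge a' b) (asp_s_dual alpha a' l) (asp_s_dual beta l b).
by rewrite /c; lia.
Qed.

Let ex_g (b : int) : exists m, forall a : int, (t a b != t a (b + 1)) = (m < a).
Proof.
have [u uP] := t0l b; have [u' uP'] := t0l (b + 1).
have [v vP] := t1l b; have [v' vP'] := t1l (b + 1).
apply: (@int_crossing (fun a => t a b != t a (b + 1))
  (Num.min u u') (Num.max v v')).
- by move=> a; move: (t_stepr a b) (t_stepr (a + 1) b) (t_monge a b); lia.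
- by rewrite uP ?uP' ?eqxx //; lia.
- by apply/eqP => /(congr1 Posz); rewrite vP ?vP'; lia.
Qed.

Let ex_g' (a : int) : exists m, forall b : int, (t (a + 1) b != t a b) = (b <= m).
Proof.
have [u uP] := t1r a; have [u' uP'] := t1r (a + 1).
have [v vP] := t0r a; have [v' vP'] := t0r (a + 1).
have [|||m mP] := @int_crossing (fun b => t (a + 1) b == t a b)
  (Num.min u u') (Num.max v v').
- by move=> b; move: (t_stepl a b) (t_stepl a (b + 1)) (t_monge a b); lia.
- by apply/eqP => /(congr1 Posz); rewrite uP ?uP'; lia.
- by rewrite vP ?vP' ?eqxx //; lia.
by exists m => b; rewrite mP leNgt.
Qed.

Let g (b : int) : int := projT1 (cid (ex_g b)).
Let g' (a : int) : int := projT1 (cid (ex_g' a)).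
Let gP (a b : int) : (t a b != t a (b + 1)) = (g b < a).
Proof. by rewrite /g; case: cid. Qed.
Let g'P (a b : int) : (t (a + 1) b != t a b) = (b <= g' a).
Proof. by rewrite /g'; case: cid. Qed.

Let gg' (a b : int) : (g b == a) = (g' a == b).
Proof.
move: (gP a b) (gP (a + 1) b) (g'P a b) (g'P a (b + 1)).
move: (t_stepl a b) (t_stepl a (b + 1)) (t_stepr a b) (t_stepr (a + 1) b).
by move: (t_monge a b); lia.
Qed.

Let gK : cancel g g'. Proof. by move=> b; apply/eqP; rewrite -gg'. Qed.
Let g'K : cancel g' g. Proof. by move=> a; apply/eqP; rewrite gg'. Qed.

Let g_sign : finite_set [set n : int | (n < 0) != (g n < 0)].
Proof.
have [u uP] := t1r 0; have [v vP] := t0r 0.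
apply: sub_finite_set (finite_int_itv (Num.min u 0) (Num.max v 0)) => n /= nP.
apply/andP; split.
  rewrite leNgt; apply/negP => nu; have := uP n; have := uP (n + 1).
  by move: (gP 0 n); lia.
rewrite ltNge; apply/negP => nv; have := vP n; have := vP (n + 1).
by move: (gP 0 n); lia.
Qed.

Lemma ex_demazure : exists gamma : ASP, is_demazure alpha beta gamma.
Proof.
pose gamma := MkASP gK g'K g_sign.
have sE a : forall b, asp_s gamma a b = t a b.
  have [u uP] := asp_s_eq0r gamma a; have [v vP] := t0r a.
  apply: (@int_iff_ind _ (Num.max u v)) => [|b].
    rewrite vP; last by lia.
    by have := @asp_s_nincr gamma a u (Num.max u v); lia.
  have -> : asp_s gamma a b = ((t a b != t a (b + 1)) + asp_s gamma a (b + 1))%N.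
    by rewrite gP; exact: asp_s_rec.
  by move: (t_stepr a b); lia.
exists gamma => a b; rewrite sE; split => [|_ [l _ <-]]; last first.
  by rewrite leEnat t_le.
by have [l ->] := t_att a b; exists l.
Qed.

End Existence.

(* By [demazureP] and [is_demazure_unique], this is the unique element satisfying
   [is_demazure alpha beta]. *)
Definition demazure (alpha beta : ASP) : ASP := projT1 (cid (ex_demazure alpha beta)).

Lemma demazureP (alpha beta : ASP) : is_demazure alpha beta (demazure alpha beta).
Proof. by rewrite /demazure; case: cid. Qed.

(* Main.v *)
Require Import Defs.
From mathcomp Require Import all_boot all_order all_algebra finmap.
From mathcomp Require Import mathcomp_extra boolp classical_sets functions cardinality.
From mathcomp Require Import zify.
Import Order.TTheory GRing.Theory Num.Theory.
Local Open Scope classical_set_scope.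
Local Open Scope ring_scope.

(** Write [s] for [asp_s] and [gamma] for the Demazure product of [alpha] and
    [beta].

    Upper bound.  If [n >= b] and [alpha1 (beta1 n) < a], then for any level [l]
    either [beta1 n < l] or [beta1 n >= l]; hence [s] is subadditive,
    [s (alpha1 beta1) a b <= s alpha1 a l + s beta1 l b]
    ([asp_s_mul_le]).  Minimizing over [l] bounds every product
    [alpha1 beta1] with [alpha1 <= alpha] and [beta1 <= beta] by [gamma].

    Attainment.  It remains to see that [beta1 := alpha^-1 gamma] satisfies
    [beta1 <= beta] with the same shift; the third maximum then follows by
    applying this to inverses, since inversion reverses Demazure products
    ([is_demazure_inv]).  The shift is additive both on products and on Demazure
    products, because it is the growth constant of [s]: [s alpha a b] is at least
    [a - b + chi alpha], with equality far to one side.  For the inequality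
    [s beta1 l b <= s beta l b], fix [l] and [b], and count the [n] that
    contribute to the left side, namely [n >= b] with [alpha^-1 (gamma n) < l],
    in the order of their values [gamma n].  With [N a] the number of those
    having [gamma n < a], the invariant
      [N a + s alpha a l <= s alpha a l' + s beta l' b   for all l' <= l]
    propagates from [a] to [a + 1] ([demazure_sweep]) by a minimizer argument.
    Taking [l' = l] gives [N a <= s beta l b] for every [a], and [N a] is
    [s beta1 l b] once [a] is large. *)

(** Either [beta n] is at least [l], and then it is counted by
    [asp_s alpha a l], or [n] itself is counted by [asp_s beta l b]. *)
Lemma asp_s_mul_le (alpha beta : ASP) (a l b : int) :
  (asp_s (alpha * beta)%g a b <= asp_s alpha a l + asp_s beta l b)%N.
Proof.
have fA := finite_asp_s alpha a l; have fB := finite_asp_s beta l b.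
rewrite {2}/asp_s; set A := fset_set _; rewrite {2}/asp_s; set B := fset_set _.
have <- : #|` [fset asp_inv beta m | m in A]%fset| = #|` A|.
  by apply: card_imfset; exact: can_inj (asp_invK beta).
apply: leq_trans (leq_card_fsetU _ _); apply: fsubset_leq_card.
apply/fsubsetP => n; rewrite in_fset_set; last exact: finite_asp_s.
rewrite inE /= => -[bn na]; rewrite in_fsetU.
have [nl|ln] := ltP (beta n) l.
  by apply/orP; right; rewrite in_fset_set // inE.
apply/orP; left; apply/imfsetP; exists (beta n); last by rewrite asp_funK.
by rewrite /= in_fset_set // inE.
Qed.

(** The shift is the least value of [asp_s gamma a b - (a - b)], attained as
    soon as [b] is small enough; so subadditivity of [asp_s] passes to it. *)
Lemma asp_chi_le_add {alpha beta gamma : ASP} :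
  (forall a l b, (asp_s gamma a b <= asp_s alpha a l + asp_s beta l b)%N) ->
  asp_chi gamma <= asp_chi alpha + asp_chi beta.
Proof.
move=> le_s; have [l l0] := asp_s_eq0l (alpha^-1)%g 0.
have [b b0] := asp_s_eq0l (beta^-1)%g l; have := le_s 0 l b.
move: (asp_s_dual alpha 0 l) (asp_s_dual beta l b) (asp_s_dual gamma 0 b).
lia.
Qed.

Lemma asp_chiV (alpha : ASP) : asp_chi (alpha^-1)%g = - asp_chi alpha.
Proof. by rewrite /asp_chi (invgK alpha); lia. Qed.

(** Subadditivity for [alpha * beta] and for its inverse give the two
    inequalities. *)
Lemma asp_chiM (alpha beta : ASP) :
  asp_chi (alpha * beta)%g = asp_chi alpha + asp_chi beta.
Proof.
have le1 := asp_chi_le_add (asp_s_mul_le alpha beta).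
have : asp_chi (alpha * beta)^-1%g <= asp_chi beta^-1%g + asp_chi alpha^-1%g.
  by rewrite invgM; apply: asp_chi_le_add; apply: asp_s_mul_le.
by rewrite !asp_chiV; lia.
Qed.

Lemma bruhat_chi_leV (alpha beta : ASP) :
  bruhat_chi_le alpha beta -> bruhat_chi_le (alpha^-1)%g (beta^-1)%g.
Proof.
move=> [/bruhat_leP le_s eq_chi]; split; last by rewrite !asp_chiV eq_chi.
apply/bruhat_leP => a b.
by move: (le_s b a) (asp_s_dual alpha b a) (asp_s_dual beta b a); lia.
Qed.

Lemma is_demazure_le {alpha beta gamma : ASP} : is_demazure alpha beta gamma ->
  forall a l b, (asp_s gamma a b <= asp_s alpha a l + asp_s beta l b)%N.
Proof. by move=> D a l b; rewrite -leEnat; apply: (D a b).2; exists l. Qed.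

(** One inequality is subadditivity.  For the other, the minimum defining
    [asp_s gamma 0 b] is attained at some [l], where it is at least
    [0 - b + asp_chi alpha + asp_chi beta]; small [b] turns this into a bound on
    [asp_chi gamma]. *)
Lemma asp_chi_demazure {alpha beta gamma : ASP} : is_demazure alpha beta gamma ->
  asp_chi gamma = asp_chi alpha + asp_chi beta.
Proof.
move=> D; have := asp_chi_le_add (is_demazure_le D).
have [b b0] := asp_s_eq0l (gamma^-1)%g 0; have [[l _ lE] _] := D 0 b.
move: lE (asp_s_dual alpha 0 l) (asp_s_dual beta l b) (asp_s_dual gamma 0 b).
lia.
Qed.

(** Inversion replaces [asp_s alpha a b] by [asp_s alpha b a] up to an affine
    term.  These terms agree on both sides because shifts add up. *)
Lemma is_demazure_inv {alpha beta gamma : ASP} : is_demazure alpha beta gamma ->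
  is_demazure (beta^-1)%g (alpha^-1)%g (gamma^-1)%g.
Proof.
move=> D a b; have chiE := asp_chi_demazure D; split => [|_ [l _ <-]].
  have [[l _ lE] _] := D b a; exists l => //.
  move: lE (asp_s_dual alpha b l) (asp_s_dual beta l a) (asp_s_dual gamma b a).
  lia.
rewrite leEnat; move: (is_demazure_le D b l a).
move: (asp_s_dual alpha b l) (asp_s_dual beta l a) (asp_s_dual gamma b a).
lia.
Qed.

(** Why the invariant survives the step from [a] to [a + 1]: the left side grows
    by at most one and the right side grows when [l' <= alpha^-1 a], so only the
    case [alpha^-1 a < l'] with [a] newly counted, [b <= gamma^-1 a], is at risk.
    Then [asp_s gamma _ b] grows at [a], so every minimizer [l0] of
    [asp_s alpha a _ + asp_s beta _ b] is at most [alpha^-1 a], hence [l'] is not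
    a minimizer.  The invariant at [l0] bounds the left side by the minimum, so
    it is strict at [l']. *)
Lemma demazure_sweep {alpha beta gamma : ASP} (l b : int) (N : int -> nat) :
    is_demazure alpha beta gamma ->
    (forall a, N (a + 1) =
      (((b <= asp_inv gamma a) && (asp_inv alpha a < l))%R + N a)%N) ->
  forall a : int,
    (forall l' : int, l' <= l ->
      (N a + asp_s alpha a l <= asp_s alpha a l' + asp_s beta l' b)%N) ->
    forall l' : int, l' <= l ->
      (N (a + 1)%R + asp_s alpha (a + 1)%R l
        <= asp_s alpha (a + 1)%R l' + asp_s beta l' b)%N.
Proof.
move=> D NS a inv l' l'l; rewrite NS !asp_s_recl.
have inv_l' := inv l' l'l.
have [|alt] := leP l' (asp_inv alpha a); first by lia.
have [bg|] := leP b (asp_inv gamma a); last by lia.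
(* [l0] is a minimizer; since [asp_s gamma _ b] grows at [a], so must the sum
   at [l0], which puts [l0] below [l']. *)
have [[l0 _ l0E] _] := D a b.
have := is_demazure_le D (a + 1) l0 b; have := is_demazure_le D (a + 1) l' b.
rewrite !asp_s_recl => le_l' le_l0.
have l0_le : l0 <= asp_inv alpha a by lia.
by have := inv l0; lia.
Qed.

(** The count [N] sorts the set counted by [asp_s (alpha^-1 * gamma) l b] by the
    values of [gamma]. *)
Lemma demazure_quotient_le {alpha beta gamma : ASP} :
  is_demazure alpha beta gamma -> (alpha^-1 * gamma <= beta)%g%O.
Proof.
move=> D; apply/bruhat_leP => l b.
have finA := finite_asp_s (alpha^-1 * gamma)%g l b.
rewrite {1}/asp_s; set A := fset_set _.
have AP n : (n \in A) = (b <= n) && (asp_inv alpha (gamma n) < l).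
  by rewrite in_fset_set //; apply/idP/andP; rewrite inE.
pose N a := count (fun n => gamma n < a) A.
have NS a : N (a + 1) =
    (((b <= asp_inv gamma a) && (asp_inv alpha a < l))%R + N a)%N.
  have -> : (b <= asp_inv gamma a) && (asp_inv alpha a < l) =
      (asp_inv gamma a \in A) by rewrite AP asp_invK.
  rewrite -(count_uniq_mem _ (fset_uniq A)) -count_predUI.
  rewrite [X in (_ + X)%N](eq_count (a2 := pred0)) ?count_pred0 ?addn0.
    apply: eq_count => n /=; rewrite ltzD1 le_eqVlt; congr orb.
    by apply/eqP/eqP => [<-|->]; rewrite ?asp_funK ?asp_invK.
  by move=> n /=; apply/andP => -[/eqP->]; rewrite asp_invK ltxx.
have [B BP] := finite_int_bound (finite_image (fun n => - gamma n) finA).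
have [B' B'P] := finite_int_bound (finite_image gamma finA).
have [a1 a1P] := asp_s_eq0l alpha l.
(* At [a0] nothing is counted yet, and [asp_s alpha a0 l] vanishes. *)
pose a0 := Num.min a1 (- B).
have sweep k l' : l' <= l -> (N (a0 + Posz k)%R + asp_s alpha (a0 + Posz k)%R l
    <= asp_s alpha (a0 + Posz k)%R l' + asp_s beta l' b)%N.
  elim: k l' => [|k IH]; last first.
    by rewrite -addn1 PoszD addrA; apply: demazure_sweep D NS _ IH.
  have -> : asp_s alpha (a0 + 0) l = 0%N.
    have := @asp_s_ndecr alpha (a0 + 0) a1 l; rewrite a1P; lia.
  suff -> : N (a0 + 0) = 0%N by [].
  apply/eqP; rewrite -leqn0 leqNgt -has_count; apply/hasPn => n nA.
  have : - gamma n < B by apply: BP; exists n => //; apply/andP; rewrite -AP.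
  by rewrite -leNgt; lia.
(* From [B'] on, everything is counted. *)
have allN : N (a0 + Posz `|B' - a0|%N) = #|` A|.
  apply/eqP; rewrite -all_count; apply/allP => n nA.
  have : gamma n < B' by apply: B'P; exists n => //; apply/andP; rewrite -AP.
  lia.
by rewrite -allN; have := sweep `|B' - a0|%N l (lexx l); lia.
Qed.

Lemma demazure_quotient {alpha beta gamma : ASP} :
  is_demazure alpha beta gamma -> bruhat_chi_le (alpha^-1 * gamma)%g beta.
Proof.
move=> D; split; first exact: demazure_quotient_le D.
by rewrite asp_chiM asp_chiV (asp_chi_demazure D); lia.
Qed.

Lemma demazure_quotientr {alpha beta gamma : ASP} :
  is_demazure alpha beta gamma -> bruhat_chi_le (gamma * beta^-1)%g alpha.
Proof.
move=> /is_demazure_inv/demazure_quotient/bruhat_chi_leV.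
by rewrite invgM !invgK.
Qed.

Lemma mul_le_demazure (alpha beta alpha1 beta1 : ASP) :
  (alpha1 <= alpha)%O -> (beta1 <= beta)%O ->
  (alpha1 * beta1 <= demazure alpha beta)%g%O.
Proof.
move=> /bruhat_leP le_a /bruhat_leP le_b; apply/bruhat_leP => a b.
have [[l _ <-] _] := demazureP alpha beta a b.
exact: leq_trans (asp_s_mul_le _ _ _ l _) (leq_add (le_a a l) (le_b l b)).
Qed.

Theorem theoremB (alpha beta : ASP) :
  [/\ is_max [set (alpha1 * beta1)%g | alpha1 in [set x : ASP | (x <= alpha)%O]
                                     & beta1 in [set y : ASP | (y <= beta)%O]]
        (demazure alpha beta),
      is_max [set (alpha * beta1)%g | beta1 in [set y : ASP | bruhat_chi_le y beta]]
        (demazure alpha beta)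
    & is_max [set (alpha1 * beta)%g | alpha1 in [set x : ASP | bruhat_chi_le x alpha]]
        (demazure alpha beta)].
Proof.
have D := demazureP alpha beta.
have quo := demazure_quotient D; have quor := demazure_quotientr D.
split; split.
- by exists alpha => /=; [|exists (alpha^-1 * demazure alpha beta)%g;
    [case: quo | rewrite mulVKg]].
- by move=> _ [alpha1 le_a [beta1 le_b <-]]; apply: mul_le_demazure.
- by exists (alpha^-1 * demazure alpha beta)%g; rewrite ?mulVKg.
- by move=> _ [beta1 [le_b _] <-]; apply: mul_le_demazure.
- by exists (demazure alpha beta * beta^-1)%g; rewrite ?mulgVK.
- by move=> _ [alpha1 [le_a _] <-]; apply: mul_le_demazure.
Qed.
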